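(* Let $T$ be a lush hedge of height $H\ge2$ and let $\Lambda=(\alpha_1,\alpha_2,\beta_2,\beta_3,\beta_4)\in\mathcal B$. Then every matrix $A\in\mathcal{PH}(C^{\Lambda}_{H+1},T)$ has a critical multiplicity list; in fact $\alpha_1,\alpha_2,\beta_2,\beta_3,\beta_4$ witness this.
   Context: Hedges: a rooted tree has a distinguished root; $y$ is a child of adjacent $z$ if the root-to-$y$ path passes through $z$; a leaf is a non-root vertex of degree 1 (in $P_1$ the single vertex is root and leaf). A hedge is a rooted tree that is $P_1$ or in which all leaves are at equal distance from the root. $\mathrm h(u)$ is the distance from $u$ to a nearest leaf; the height of the hedge is that of its root; $V_i(T)$ is the set of vertices of height $i$; $\ell_i(T)=|V_{i-1}(T)|-|V_i(T)|$ for $i\ge1$. A hedge is lush if every vertex of height $\ge2$ has at least three children and every vertex of height $1$ at least two. $P_n$ is the path $1-\cdots-n$ rooted at $1$. $\mathcal R(T)$: real matrices indexed by $V(T)$ with $a_{ij}\neq0$ iff $\{i,j\}\in E(T)$ ($i\ne j$), $a_{ij}a_{ji}>0$ on edges, arbitrary diagonal. Path-to-hedge: for $C=(c_{ij})\in\mathcal R(P_{H+1})$ and $v\in V(T)$ put $v'=H+1-\mathrm h(v)$; $\mathcal{PH}(C,T)$ is the set of $A\in\mathcal R(T)$ with $a_{vv}=c_{v'v'}$ for all $v$ and $\sum_{u\text{ child of }v}a_{vu}a_{uv}=c_{v',v'+1}c_{v'+1,v'}$ for every non-leaf $v$. $\mathcal B$ is the set of $(\alpha_1,\alpha_2,\beta_2,\beta_3,\beta_4)\in\mathbb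 R^5$ with distinct entries satisfying one of: $\beta_2<\alpha_1<\alpha_2<\beta_3<\beta_4$; $\beta_2<\beta_4<\alpha_1<\alpha_2<\beta_3$; $\beta_4<\beta_2<\alpha_1<\alpha_2<\beta_3$ and $\alpha_2+\beta_2>\beta_4+\beta_3$; $\beta_3<\beta_2<\alpha_1<\alpha_2<\beta_4$ and $\alpha_2+\beta_2<\beta_4+\beta_3$; $\beta_3<\beta_2<\beta_4<\alpha_1<\alpha_2$; $\beta_4<\beta_3<\beta_2<\alpha_1<\alpha_2$; $\beta_4<\beta_3<\alpha_2<\alpha_1<\beta_2$; $\beta_3<\alpha_2<\alpha_1<\beta_4<\beta_2$; $\beta_3<\alpha_2<\alpha_1<\beta_2<\beta_4$ and $\alpha_2+\beta_2<\beta_4+\beta_3$; $\beta_4<\alpha_2<\alpha_1<\beta_2<\beta_3$ and $\alpha_2+\beta_2>\beta_4+\beta_3$; $\alpha_2<\alpha_1<\beta_4<\beta_2<\beta_3$; $\alpha_2<\alpha_1<\beta_2<\beta_3<\beta_4$. For $\Lambda\in\mathcal B$, $C^{\Lambda}_n$ is the $n\times n$ tridiagonal matrix with diagonal $(a_n,\dots,a_1)$, superdiagonal $(b_n,\dots,b_2)$, subdiagonal all $1$, where $a_i=\alpha_1$ ($i$ odd), $a_2=-\alpha_1+\alpha_2+\beta_2$, $a_i=\alpha_2$ ($i>2$ even), $b_2=(\beta_2-\alpha_1)(\alpha_1-\alpha_2)$, $b_3=(\beta_3-\alpha_2)(\beta_3-\beta_2)$, $b_4=\frac{(\beta_4-\alpha_1)(\beta_3-\beta_4)(\alpha_2+\beta_2-\beta_3-\beta_4)}{\beta_4-\beta_2}$,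 $b_i=(\beta_j-\alpha_1)(\beta_j-\alpha_2)$ for $i>4$, $j\in\{2,3,4\}$, $i\equiv j\pmod3$. Critical multiplicity list: for a lush hedge $T$ of height $H\ge2$, a matrix $A\in\mathcal R(T)$ has a critical multiplicity list if there exist five distinct reals $\alpha_1,\alpha_2,\beta_2,\beta_3,\beta_4$ (witnesses) with $\mathrm{mult}(\alpha_j,A)\ge\sum_{i\ge j,\ i\equiv j\ (2)}\ell_i(T)$ for $j=1,2$, $\mathrm{mult}(\beta_j,A)\ge\sum_{i\ge j,\ i\equiv j\ (3)}\ell_i(T)$ for $j=2,3,4$, and $\mathrm{mult}(\beta_4,A)<\ell_3(T)$ (multiplicity $0$ allowed, i.e. $\beta_4$ need not be an eigenvalue). *)

(* Defs.v *)
From HB Require Import structures.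
From mathcomp Require Import all_boot all_order all_algebra.
From mathcomp Require Import reals.
Set Implicit Arguments. Unset Strict Implicit. Unset Printing Implicit Defensive.
Import Order.TTheory GRing.Theory Num.Theory.
Local Open Scope ring_scope.

Section Trees.
Variable n : nat.
Variable adj : rel 'I_n.
Variable r : 'I_n.

Definition is_tree : Prop :=
  [/\ symmetric adj, irreflexive adj,
      (forall u v, connect adj u v) &
      #|[set e : 'I_n * 'I_n | adj e.1 e.2]| = (2 * n.-1)%N].

Definition walk (k : nat) (u v : 'I_n) : bool :=
  [exists t : k.-tuple 'I_n, path adj u t && (last u t == v)].

(* graph distance (for connected graphs on n vertices it is < n) *)
Definition dist (u v : 'I_n) : nat := find (fun k => walk k u v) (iota 0 n).

(* y is a child of the adjacent vertex z: z lies on the root-to-y path *)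
Definition child (y z : 'I_n) : bool :=
  adj z y && (dist r y == (dist r z + dist z y)%N).

Definition children (z : 'I_n) : {set 'I_n} := [set y | child y z].

Definition leaf (v : 'I_n) : bool :=
  if n == 1%N then true
  else (v != r) && (#|[set u | adj v u]| == 1%N).

Definition hgt (u : 'I_n) : nat :=
  \big[minn/n]_(l | leaf l) dist u l.

Definition height : nat := hgt r.

Definition Vset (i : nat) : {set 'I_n} := [set v | hgt v == i].

Definition ell (i : nat) : int := (#|Vset i.-1|)%:Z - (#|Vset i|)%:Z.

Definition is_hedge : Prop :=
  is_tree /\ (n = 1%N \/ forall l l', leaf l -> leaf l' -> dist r l = dist r l').

Definition is_lush : Prop :=
  is_hedge /\
  (forall v, (2 <= hgt v)%N -> (3 <= #|children v|)%N) /\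
  (forall v, hgt v = 1%N -> (2 <= #|children v|)%N).

End Trees.

(* the path P_m : 0 - 1 - ... - (m-1), rooted at 0 (vertex k here is k+1 *)
(* of the paper) *)
Definition path_adj (m : nat) : rel 'I_m :=
  fun i j => (i.+1 == j :> nat) || (j.+1 == i :> nat).

Section Matrices.
Variable R : realType.

Definition Rclass n (adj : rel 'I_n) (A : 'M[R]_n) : Prop :=
  (forall i j, i != j -> (A i j != 0) = adj i j) /\
  (forall i j, adj i j -> 0 < A i j * A j i).

Definition mult n (x : R) (A : 'M[R]_n) : nat := mup x (char_poly A).

(* path-to-hedge: PH(C,T) for C in 'M_(H+1), H the height of T.          *)
(* With 0-based indices, v' of the paper is the index H - h(v), and       *)
(* v'+1 is the index H - h(v) + 1.                                       *)
Definition PH n (adj : rel 'I_n) (r : 'I_n)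
    (C : 'M[R]_((height adj r).+1)) (A : 'M[R]_n) : Prop :=
  Rclass adj A /\
  (forall v : 'I_n, A v v = C (inord (height adj r - hgt adj r v))
                             (inord (height adj r - hgt adj r v))) /\
  (forall v : 'I_n, ~~ leaf adj r v ->
     \sum_(u | child adj r u v) A v u * A u v =
     C (inord (height adj r - hgt adj r v))
       (inord (height adj r - hgt adj r v).+1) *
     C (inord (height adj r - hgt adj r v).+1)
       (inord (height adj r - hgt adj r v))).

Definition inB (a1 a2 b2 b3 b4 : R) : Prop :=
  uniq [:: a1; a2; b2; b3; b4] /\
  (   (b2 < a1 < a2 /\ a2 < b3 < b4)
   \/ (b2 < b4 < a1 /\ a1 < a2 < b3)
   \/ ((b4 < b2 < a1 /\ a1 < a2 < b3) /\ a2 + b2 > b4 + b3)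
   \/ ((b3 < b2 < a1 /\ a1 < a2 < b4) /\ a2 + b2 < b4 + b3)
   \/ (b3 < b2 < b4 /\ b4 < a1 < a2)
   \/ (b4 < b3 < b2 /\ b2 < a1 < a2)
   \/ (b4 < b3 < a2 /\ a2 < a1 < b2)
   \/ (b3 < a2 < a1 /\ a1 < b4 < b2)
   \/ ((b3 < a2 < a1 /\ a1 < b2 < b4) /\ a2 + b2 < b4 + b3)
   \/ ((b4 < a2 < a1 /\ a1 < b2 < b3) /\ a2 + b2 > b4 + b3)
   \/ (a2 < a1 < b4 /\ b4 < b2 < b3)
   \/ (a2 < a1 < b2 /\ b2 < b3 < b4)).

(* the sequences a_i, b_i (1-based, as in the paper) *)
Definition seq_a (a1 a2 b2 : R) (i : nat) : R :=
  if odd i then a1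
  else if i == 2%N then - a1 + a2 + b2
  else a2.

Definition seq_b (a1 a2 b2 b3 b4 : R) (i : nat) : R :=
  if i == 2%N then (b2 - a1) * (a1 - a2)
  else if i == 3%N then (b3 - a2) * (b3 - b2)
  else if i == 4%N then (b4 - a1) * (b3 - b4) * (a2 + b2 - b3 - b4) / (b4 - b2)
  else let bj := match (i %% 3)%N with 2 => b2 | 0 => b3 | _ => b4 end in
       (bj - a1) * (bj - a2).

(* C^Lambda_m: diagonal (a_m,...,a_1), superdiagonal (b_m,...,b_2),       *)
(* subdiagonal all 1 (0-based: entry (i,i) is a_{m-i}, (i,i+1) is b_{m-i}) *)
Definition CLambda (a1 a2 b2 b3 b4 : R) (m : nat) : 'M[R]_m :=
  \matrix_(i < m, j < m)
    if i == j :> nat then seq_a a1 a2 b2 (m - i)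
    else if i.+1 == j :> nat then seq_b a1 a2 b2 b3 b4 (m - i)
    else if j.+1 == i :> nat then 1
    else 0.

(* sum_{i >= j, i = j mod p} l_i(T)  (l_i = 0 for i > n + 1)             *)
Definition ell_sum n (adj : rel 'I_n) (r : 'I_n) (p j : nat) : int :=
  \sum_(j <= i < n.+2 | ((i - j) %% p == 0)%N) ell adj r i.

Definition cml_witness n (adj : rel 'I_n) (r : 'I_n) (A : 'M[R]_n)
    (a1 a2 b2 b3 b4 : R) : Prop :=
  uniq [:: a1; a2; b2; b3; b4] /\
  (mult a1 A)%:Z >= ell_sum adj r 2 1 /\
  (mult a2 A)%:Z >= ell_sum adj r 2 2 /\
  (mult b2 A)%:Z >= ell_sum adj r 3 2 /\
  (mult b3 A)%:Z >= ell_sum adj r 3 3 /\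
  (mult b4 A)%:Z >= ell_sum adj r 3 4 /\
  (mult b4 A)%:Z < ell adj r 3.

Definition has_cml n (adj : rel 'I_n) (r : 'I_n) (A : 'M[R]_n) : Prop :=
  Rclass adj A /\
  exists a1 a2 b2 b3 b4 : R, cml_witness adj r A a1 a2 b2 b3 b4.

End Matrices.

(* Main.v *)
(** Let [p_k] be the characteristic polynomial of the trailing [k x k] block of
    the tridiagonal matrix.  Eliminating the vertices of the tree from the
    leaves upwards, every vertex of height [h] gets the pivot [p_(h+1) / p_h],
    so [char_poly A] is the product of the [p_i ^ l_i] and the multiplicity of
    [x] in [A] is the sum of the [l_i] times the multiplicity of [x] in [p_i].
    The entries of the matrix are chosen so that [a1] and [a2] are roots of
    every second [p_i] and [b2], [b3], [b4] of every third one.  As the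
    off-diagonal entries [b_i] are positive, the [p_i] have simple roots, and
    consecutive ones have no common root, so [b4] is a root of [p_i] only for
    [i >= 4]; its multiplicity is then at most [l_4 + l_5 + ...], which
    telescopes to [|V_3| < l_3]. *)

Require Import Defs.
From HB Require Import structures.
From mathcomp Require Import all_boot all_order all_algebra all_fingroup.
From mathcomp Require Import reals fraction ring lra zify.
Set Implicit Arguments.
Unset Strict Implicit.
Unset Printing Implicit Defensive.
Import Order.TTheory GRing.Theory Num.Theory.
Local Open Scope ring_scope.

(** * Distances and rooted trees *)

Section Distance.
Variables (n : nat) (adj : rel 'I_n).
Local Notation dist := (dist adj).
Local Notation walk := (walk adj).

Lemma walkP k u v :
  reflect (exists p, [/\ size p = k, path adj u p & last u p = v])
          (walk k u v).
Proof.
apply: (iffP existsP) => [[t /andP[pt /eqP lt]]|[p [sp pp lp]]].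
  by exists t; rewrite size_tuple.
have sp' : size p == k by apply/eqP.
by exists (Tuple sp'); rewrite pp; apply/eqP.
Qed.

(** [dist] is an index found in [iota 0 n], hence at most [n]: a bound [k >= n] is automatic, and a
    walk of smaller length would have stopped the search. *)
Lemma dist_leq_walk k u v : walk k u v -> (dist u v <= k)%N.
Proof.
move=> w; rewrite leqNgt; apply/negP => kd.
have kn : (k < n)%N.
  by apply: leq_trans kd _; rewrite -[n in leqRHS](size_iota 0) find_size.
by have := before_find 0%N kd; rewrite nth_iota // add0n w.
Qed.

Hypothesis adj_connected : forall u v, connect adj u v.

(** A duplicate-free path has fewer than [n] edges, so [find] does not return its default [n]. *)
Lemma dist_lt u v : (dist u v < n)%N.
Proof.
rewrite -[n in ltnRHS](size_iota 0) -has_find; apply/hasP.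
have /connectP[p pp ->] := adj_connected u v.
case: (shortenP pp) => p' pp' up' _.
exists (size p'); last by apply/walkP; exists p'.
rewrite mem_iota add0n /=.
by have /card_uniqP/= := up' => <-; rewrite -[leqRHS](card_ord n) max_card.
Qed.

Lemma walk_dist u v : walk (dist u v) u v.
Proof.
have h : has (fun k => walk k u v) (iota 0 n).
  by rewrite has_find size_iota dist_lt.
by have := nth_find 0%N h; rewrite nth_iota ?add0n // dist_lt.
Qed.

Lemma distxx u : dist u u = 0%N.
Proof. by apply/eqP; rewrite -leqn0; apply: dist_leq_walk; apply/walkP; exists [::]. Qed.

Lemma dist_eq0 u v : (dist u v == 0%N) = (u == v).
Proof.
apply/eqP/eqP => [d0|->]; last exact: distxx.
by have := walk_dist u v; rewrite d0 => /walkP[[|? ?] [//]].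
Qed.

Lemma dist_triangle v u w : (dist u w <= dist u v + dist v w)%N.
Proof.
have /walkP[p [sp pp lp]] := walk_dist u v.
have /walkP[q [sq pq lq]] := walk_dist v w.
apply: dist_leq_walk; apply/walkP; exists (p ++ q).
by rewrite size_cat sp sq cat_path pp lp pq last_cat lp lq.
Qed.

Lemma dist_adj u v : irreflexive adj -> adj u v -> dist u v = 1%N.
Proof.
move=> irr uv; apply/eqP; rewrite eqn_leq lt0n dist_eq0.
apply/andP; split; first by apply: dist_leq_walk; apply/walkP; exists [:: v]; rewrite /= uv.
by apply: contraTneq uv => ->; rewrite irr.
Qed.

End Distance.

Section Tree.
Variables (n : nat) (adj : rel 'I_n) (r : 'I_n).
Hypothesis treeT : is_tree adj.
Local Notation dist := (dist adj).
Local Notation child := (child adj r).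

Let adj_sym : symmetric adj. Proof. by case: treeT. Qed.
Let adj_irr : irreflexive adj. Proof. by case: treeT. Qed.
Let adj_connected : forall u v, connect adj u v. Proof. by case: treeT. Qed.

Lemma child_depth y z : child y z = adj z y && (dist r y == (dist r z).+1).
Proof.
by rewrite /Defs.child; case zy: (adj z y) => //=; rewrite (dist_adj adj_connected adj_irr zy) addn1.
Qed.

(** The parent is the last vertex but one on a shortest walk from the root. *)
Lemma parent_exists y : y != r -> exists z, child y z.
Proof.
rewrite eq_sym -(dist_eq0 adj_connected) => d0.
have /walkP[p []] := walk_dist adj_connected r y.
case/lastP: p => [|p y'] /=; first by move=> e; rewrite -e in d0.
rewrite size_rcons rcons_path last_rcons => sp /andP[pp zy'] ey; subst y'.
exists (last r p); rewrite child_depth zy' -sp eqSS /=.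
rewrite eqn_leq; apply/andP; split.
  by rewrite -ltnS sp -addn1 -(dist_adj adj_connected adj_irr zy') dist_triangle.
by apply: dist_leq_walk; apply/walkP; exists p.
Qed.

Let C := [set e : 'I_n * 'I_n | child e.1 e.2].
Let swap (e : 'I_n * 'I_n) := (e.2, e.1).

Let swap_inj : injective swap.
Proof. by move=> [a b] [c d] [-> ->]. Qed.

Let mem_swapC e : (e \in swap @: C) = child e.2 e.1.
Proof.
by rewrite -[e in LHS](_ : swap (swap e) = e) ?mem_imset // ?inE //; case: e.
Qed.

Let childC y z : child y z -> ~~ child z y.
Proof.
rewrite !child_depth => /andP[_ /eqP ->]; rewrite negb_and.
by apply/orP; right; lia.
Qed.

Let cards_sub : C :|: swap @: C \subset [set e | adj e.1 e.2].
Proof.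
apply/subsetP => e; rewrite in_setU mem_swapC !inE.
by case/orP => /andP[]//; rewrite adj_sym.
Qed.

Let card_CU : #|C :|: swap @: C| = (2 * #|C|)%N.
Proof.
rewrite cardsU card_imset // (_ : C :&: _ = set0) ?cards0; first by lia.
by apply/setP => e; rewrite in_setI mem_swapC !inE; case h: child => //=; apply/negbTE/childC.
Qed.

Let C_fst : fst @: C = [set~ r].
Proof.
apply/setP => y; rewrite !inE; apply/imsetP/idP.
  case=> -[y' z]; rewrite inE child_depth /= => /andP[_ /eqP d] ->.
  by apply: contra_eq_neq d => ->; rewrite distxx.
by move=> /parent_exists[z yz]; exists (y, z); rewrite ?inE.
Qed.

(* A tree has [n.-1] edges, and every non-root vertex has a parent, so each
   edge joins a vertex to its parent and parents are unique. *)
Let card_C : #|C| = n.-1.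
Proof.
apply/eqP; rewrite eqn_leq; apply/andP; split.
  have := subset_leq_card cards_sub; rewrite card_CU.
  by case: treeT => _ _ _ ->; rewrite leq_pmul2l.
by have := leq_imset_card fst C; rewrite C_fst cardsC1 card_ord.
Qed.

Lemma parent_unique y z z' : child y z -> child y z' -> z = z'.
Proof.
have /imset_injP inj : #|fst @: C| == #|C| by rewrite C_fst cardsC1 card_ord card_C.
by move=> yz yz'; have := inj (y, z) (y, z'); rewrite !inE /= => /(_ yz yz' erefl)[].
Qed.

(** Both orientations of the child relation together already number [2 * n.-1], so they exhaust the
    directed edges. *)
Lemma adj_childE u v : adj u v = child u v (+) child v u.
Proof.
have : C :|: swap @: C == [set e | adj e.1 e.2].
  rewrite eqEcard cards_sub card_CU card_C.
  by case: treeT => _ _ _ ->; rewrite leqnn.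
move/eqP/setP/(_ (u, v)); rewrite in_setU mem_swapC !inE /= => <-.
by have := @childC u v; case: (child u v) => //= /(_ isT)/negbTE ->.
Qed.

(** The root starts a walk to any other vertex; a non-root non-leaf has a neighbour besides its
    parent, which is a child because parents are unique. *)
Lemma child_exists v : ~~ leaf adj r v -> exists u, child u v.
Proof.
rewrite /leaf; case: eqP => // /eqP n1; rewrite negb_and negbK.
have n2 : (1 < n)%N by have := ltn_ord r; lia.
case: (eqVneq v r) => [-> _|vr /= deg].
  have [y yr] : exists y, y != r.
    have [e|e] := eqVneq r (Ordinal n2); last by exists (Ordinal n2); rewrite eq_sym.
    by exists (Ordinal (ltnW n2)); rewrite e.
  have /connectP[[|z p] /= pp ly] := adj_connected r y; first by rewrite ly eqxx in yr.
  have /andP[rz _] := pp; exists z; move: rz; rewrite adj_childE.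
  case h: (child r z) => //=; move: h; rewrite child_depth distxx //.
  by rewrite andbF.
have [z vz] := parent_exists vr.
have zv : adj v z by rewrite adj_childE vz (negbTE (childC vz)).
have [u vu uz] : exists2 u, adj v u & u != z.
  have : (1 < #|[set u | adj v u]|)%N.
    rewrite ltn_neqAle eq_sym deg /=; apply/card_gt0P; exists z; by rewrite inE.
  rewrite (cardsD1 z) inE zv ltnS => /card_gt0P[u].
  by rewrite !inE => /andP[uz vu]; exists u.
exists u; move: vu; rewrite adj_childE; case h: (child v u) => //=.
by rewrite (parent_unique h vz) eqxx in uz.
Qed.

(** * Heights when all leaves have equal depth *)

Hypothesis leaf_depth : forall l l', leaf adj r l -> leaf adj r l' -> dist r l = dist r l'.

(** Descending from child to child must end in a leaf, since depth grows by one each time and stays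
    below [n]. *)
Lemma leaf_below u :
  exists2 l, leaf adj r l & (dist r u + dist u l)%N = dist r l.
Proof.
have [k] := ubnP (n - dist r u); elim: k u => // k IH u hk.
case lu: (leaf adj r u); first by exists u; rewrite // distxx // addn0.
have [c cu] := child_exists (negbT lu).
move: cu; rewrite child_depth => /andP[uc /eqP dc].
have dlt := dist_lt adj_connected r c.
have [|l ll lc] := IH c; first by lia.
exists l => //; have := dist_triangle adj_connected c u l.
have := dist_triangle adj_connected u r l.
rewrite (dist_adj adj_connected adj_irr uc); lia.
Qed.

(** A leaf below [u] attains the minimum: by the triangle inequality no leaf of the same depth is
    nearer, and the default [n] exceeds every distance. *)
Lemma hgt_leaf u l : leaf adj r l -> (hgt adj r u + dist r u)%N = dist r l.
Proof.
move=> ll; have [l0 ll0 e0] := leaf_below u.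
rewrite -(leaf_depth ll0 ll) -e0 addnC; congr addn; rewrite /hgt.
apply/eqP; rewrite eqn_leq; apply/andP; split.
  elim: (index_enum _) (mem_index_enum l0) => // i s IH.
  rewrite inE big_cons => /predU1P[<-|/IH le]; first by rewrite ll0 geq_minl.
  by case: ifP => // _; rewrite geq_min le orbT.
elim/big_ind: _ => [|x y|l' ll'].
- by rewrite ltnW // dist_lt.
- by rewrite leq_min => -> ->.
- have := dist_triangle adj_connected u r l'; rewrite (leaf_depth ll' ll0); lia.
Qed.

Lemma hgt_depth u : (hgt adj r u + dist r u)%N = height adj r.
Proof.
have [l ll _] := leaf_below r.
by rewrite (hgt_leaf u ll) -(hgt_leaf r ll) distxx // addn0.
Qed.

Lemma hgt_child y z : child y z -> hgt adj r z = (hgt adj r y).+1.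
Proof.
by rewrite child_depth => /andP[_ /eqP d]; have := hgt_depth y; have := hgt_depth z; lia.
Qed.

Lemma hgt_eq0 v : (hgt adj r v == 0%N) = leaf adj r v.
Proof.
case lv: (leaf adj r v); first by have := hgt_leaf v lv; lia.
by have [u /hgt_child ->] := child_exists (negbT lv).
Qed.

Lemma hgt_le_height v : (hgt adj r v <= height adj r)%N.
Proof. by rewrite -(hgt_depth v) leq_addr. Qed.

Lemma height_lt : (height adj r < n)%N.
Proof. 
by have [l ll _] := leaf_below r; rewrite -(hgt_depth l) (hgt_leaf l ll) dist_lt.
Qed.

Lemma Vset_nonempty i : (i <= height adj r)%N -> exists v, hgt adj r v = i.
Proof.
move=> iH; rewrite -(subKn iH); elim: (height adj r - i)%N (leq_subr i (height adj r)) => [|k IH] kH.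
  by exists r; rewrite subn0.
have [v hv] := IH (ltnW kH).
have [|u uv] := @child_exists v; first by rewrite -hgt_eq0 hv; lia.
by exists u; have := hgt_child uv; rewrite hv; lia.
Qed.

(** Double counting of the child-parent pairs between two levels; each child is counted at most
    once. *)
Lemma Vset_children m i : (forall v, hgt adj r v = i.+1 -> (m <= #|children adj r v|)%N) ->
  (m * #|Vset adj r i.+1| <= #|Vset adj r i|)%N.
Proof.
move=> hm.
apply: (@leq_trans (\sum_(v in Vset adj r i.+1) #|children adj r v|)).
  rewrite mulnC -sum_nat_const; apply: leq_sum => v; rewrite inE => /eqP; exact: hm.
under eq_bigr => v _ do rewrite -sum1_card.
rewrite (exchange_big_dep (mem (Vset adj r i))) /=; last first.
  by move=> v u; rewrite !inE => /eqP hv /hgt_child; rewrite hv => -[->].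
rewrite -[leqRHS]sum1_card; apply: leq_sum => u _; rewrite sum1_card.
apply/card_le1_eqP => v v' /andP[_ +] /andP[_ +]; rewrite !inE => uv uv'.
by rewrite (parent_unique uv uv').
Qed.

End Tree.

(** * Characteristic polynomials of forest matrices *)

(** If all [M i (s i)] are nonzero, [f] drops from [i] to [s i] wherever [s] moves a point; but [s]
    only rearranges the sum of [f], so [s] is the identity. *)
Lemma det_triangular_rank (R : comNzRingType) n (f : 'I_n -> nat) (M : 'M[R]_n) :
  (forall i j, i != j -> M i j != 0 -> (f j < f i)%N) ->
  \det M = \prod_i M i i.
Proof.
move=> Mtri; rewrite /determinant (bigD1 (1%g : {perm 'I_n})) //= odd_perm1 mul1r.
under eq_bigr do rewrite perm1.
rewrite [X in _ + X]big1 ?addr0 // => s s1.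
have [/existsP[i /eqP Mi0]|] := boolP [exists i, M i (s i) == 0].
  by rewrite (bigD1 i) //= Mi0 mul0r mulr0.
rewrite negb_exists => /forallP Mn0; case/eqP: s1; apply/permP => i; rewrite perm1.
have fle j : (f (s j) <= f j)%N.
  by have [->//|sj] := eqVneq (s j) j; apply: ltnW; apply: Mtri (Mn0 j); rewrite eq_sym.
apply/eqP; apply: contraT => si.
have : (\sum_j f (s j) < \sum_j f j)%N.
  rewrite (bigD1 i) //= [ltnRHS](bigD1 i) //= -addSn leq_add //.
    by apply: Mtri (Mn0 i); rewrite eq_sym.
  by apply: leq_sum.
by rewrite [X in (_ < X)%N](reindex_inj (@perm_inj _ s)) ltnn.
Qed.

(* [M] has an LU factorization in which the pivots are the [q v]. *)
Lemma det_forest (F : fieldType) n (ch : rel 'I_n) (f : 'I_n -> nat)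
    (M : 'M[F]_n) (q : 'I_n -> F) :
  (forall u v, ch u v -> (f u < f v)%N) ->
  (forall u v w, ch u v -> ch u w -> v = w) ->
  (forall v w, v != w -> ~~ ch v w -> ~~ ch w v -> M v w = 0) ->
  (forall v, q v != 0) ->
  (forall v, M v v = q v + \sum_(u | ch u v) M v u * M u v / q u) ->
  \det M = \prod_v q v.
Proof.
move=> chf chU M0 q0 Mq.
have chxx v : ch v v = false by apply/negP => /chf; rewrite ltnn.
pose L := \matrix_(v, u) (if v == u then q v else if ch u v then M v u else 0).
pose U := \matrix_(u, w) (if u == w then 1 else if ch u w then M u w / q u else 0).
have -> : M = L *m U.
  apply/matrixP => v w; rewrite mxE.
  have [<-|vw] := eqVneq v w.
    rewrite Mq [RHS](bigD1 v) //= !mxE eqxx mulr1; congr (_ + _).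
    rewrite big_mkcond [RHS]big_mkcond; apply: eq_bigr => u _ /=.
    rewrite !mxE eq_sym; have [->|_] := eqVneq u v; first by rewrite chxx.
    by case: ifP; rewrite ?mul0r ?mulrA.
  (* Any further nonzero term would come from a common child of [v] and [w]. *)
  rewrite (bigD1 v) // (bigD1 w) ?(eq_sym w) //= big1 => [|u /andP[uv uw]]; last first.
    rewrite !mxE eq_sym (negbTE uv) (negbTE uw).
    case: ifP => [cv|]; last by rewrite mul0r.
    by case: ifP => [cw|]; rewrite ?mulr0 //; rewrite (chU _ _ _ cv cw) eqxx in vw.
  rewrite !mxE !eqxx (negbTE vw) addr0 mulr1.
  case: ifP => cvw.
    have -> : ch w v = false by apply/negP => /chf; have := chf _ _ cvw; lia.
    by rewrite addr0 mulrC divfK.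
  by rewrite mulr0 add0r; case: ifP => // cwv; rewrite M0 ?cvw ?cwv.
rewrite det_mulmx -[RHS]mulr1; congr (_ * _).
  rewrite (det_triangular_rank (f := f)) => [|v u vu]; last first.
    by rewrite mxE (negbTE vu); case: ifP => [/chf//|_ /eqP].
  by apply: eq_bigr => v _; rewrite mxE eqxx.
rewrite -det_tr (det_triangular_rank (f := f)) => [|v u vu]; last first.
  by rewrite !mxE (eq_sym u) (negbTE vu); case: ifP => [/chf//|_ /eqP].
by rewrite big1 // => v _; rewrite !mxE eqxx.
Qed.

(** * Continuants of a tridiagonal matrix *)

Section Continuant.
Variables (R : fieldType) (a b : nat -> R).

(** Here [b i] stands for the product of the two off-diagonal entries that join the positions of
    [a i] and [a i.-1]. *)
Fixpoint continuant (k : nat) : {poly R} :=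
  match k with
  | 0 => 1
  | k'.+1 => match k' with
             | 0 => 'X - (a 1)%:P
             | k''.+1 => ('X - (a k)%:P) * continuant k' - b k *: continuant k''
             end
  end.

Lemma continuantSS k :
  continuant k.+2 = ('X - (a k.+2)%:P) * continuant k.+1 - b k.+2 *: continuant k.
Proof. by []. Qed.

Lemma continuant_monic_size k : (continuant k \is monic) * (size (continuant k) = k.+1).
Proof.
suff [] : (continuant k \is monic) * (size (continuant k) = k.+1) /\
          (continuant k.+1 \is monic) * (size (continuant k.+1) = k.+2) by [].
elim: k => [|k [IH0 IH1]].
  by rewrite /= monicXsubC size_XsubC monic1 size_poly1.
split=> //; rewrite continuantSS.
have sM : size (('X - (a k.+2)%:P) * continuant k.+1) = k.+3.
  by rewrite size_Mmonic ?IH1 // ?monic_neq0 ?monicXsubC // size_XsubC.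
have sl : (size (- (b k.+2 *: continuant k)) < size (('X - (a k.+2)%:P) * continuant k.+1)%R)%N.
  by rewrite sM size_polyN (leq_ltn_trans (size_scale_leq _ _)) // IH0.
split; last by rewrite size_polyDl.
by rewrite monicE lead_coefDl // -monicE monicMl ?monicXsubC // IH1.
Qed.

Lemma continuant_monic k : continuant k \is monic.
Proof. by rewrite continuant_monic_size. Qed.

Lemma continuant_neq0 k : continuant k != 0.
Proof. by rewrite monic_neq0 ?continuant_monic. Qed.

Lemma continuantSS_horner k x : (continuant k.+2).[x] =
  (x - a k.+2) * (continuant k.+1).[x] - b k.+2 * (continuant k).[x].
Proof. by rewrite continuantSS !hornerE. Qed.

(** A common root of neighbours would descend along the recurrence to [continuant 0 = 1]. *)
Lemma continuant_coprime k x : (forall i, (2 <= i)%N -> b i != 0) ->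
  root (continuant k) x -> ~~ root (continuant k.+1) x.
Proof.
move=> b0; elim: k => [|k IH]; first by rewrite /= rootC oner_eq0.
move=> rk; apply/negP; rewrite /root continuantSS_horner (eqP rk) mulr0 sub0r oppr_eq0.
rewrite mulf_eq0 (negbTE (b0 _ _)) //= => r0.
by move/IH: r0; rewrite rk.
Qed.

End Continuant.

(* The Wronskian [W_k] of consecutive continuants satisfies
   [W_(k+1) = continuant k ^ 2 + b_(k+1) W_k], so it is positive everywhere. *)
Lemma continuant_wronskian_gt0 (R : realFieldType) (a b : nat -> R) k x :
  (forall i, (2 <= i)%N -> 0 < b i) ->
  0 < (continuant a b k.+1)^`().[x] * (continuant a b k).[x]
      - (continuant a b k.+1).[x] * (continuant a b k)^`().[x].
Proof.
move=> b0; elim: k => [|k IH].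
  by rewrite /= derivXsubC derivC !hornerE subr0 ltr01.
have bk : 0 < b k.+2 by apply: b0.
have -> : (continuant a b k.+2)^`().[x] = (continuant a b k.+1).[x]
    + (x - a k.+2) * (continuant a b k.+1)^`().[x] - b k.+2 * (continuant a b k)^`().[x].
  by rewrite continuantSS derivB derivM derivXsubC derivZ !hornerE.
rewrite continuantSS_horner.
set p := _.[x] in IH *; set p' := (continuant a b k.+1)^`().[x] in IH *.
set q := (continuant a b k).[x] in IH *; set q' := (continuant a b k)^`().[x] in IH *.
have := mulr_gt0 bk IH.
have := sqr_ge0 p; nra.
Qed.

(** At a root the Wronskian reduces to the derivative times the previous continuant; being positive,
    it excludes a double root. *)
Lemma mup_continuant (R : realFieldType) (a b : nat -> R) k x :
  (forall i, (2 <= i)%N -> 0 < b i) ->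
  mup x (continuant a b k) = root (continuant a b k) x.
Proof.
move=> b0; have [rx|] := boolP (root _ x); last exact: mupNroot.
apply/eqP; rewrite eqn_leq /= -XsubC_dvd ?continuant_neq0 // dvdp_XsubCl rx andbT.
rewrite mup_leq ?continuant_neq0 //; apply/negP => /dvdpP[q e].
case: k rx e => [|k] rx e; first by move: rx; rewrite /= rootC oner_eq0.
have := continuant_wronskian_gt0 a k x b0.
rewrite (eqP rx) mul0r subr0 e derivM deriv_exp !hornerE /= subrr.
by rewrite !(mul0r, mulr0, addr0, expr0n) ltxx.
Qed.

Lemma mup_prod (F : fieldType) (I : finType) (x : F) (P : I -> {poly F}) :
  (forall i, P i != 0) -> mup x (\prod_i P i) = (\sum_i mup x (P i))%N.
Proof.
move=> P0; suff [] : \prod_i P i != 0 /\ mup x (\prod_i P i) = (\sum_i mup x (P i))%N by [].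
elim/big_ind2: _ => [|m p m' p' [p0 <-] [p0' <-]|i _]; last by split.
  by rewrite oner_neq0 mupNroot // rootC oner_neq0.
by rewrite mulf_neq0 // mupM.
Qed.

(** * Eigenvalue multiplicities on a lush hedge *)

Section HedgeMatrix.
Variables (n : nat) (adj : rel 'I_n) (r : 'I_n).
Hypothesis treeT : is_tree adj.
Hypothesis leaf_depth :
  forall l l', leaf adj r l -> leaf adj r l' -> dist adj r l = dist adj r l'.
Local Notation hgt := (hgt adj r).
Local Notation child := (child adj r).
Local Notation V := (Vset adj r).

Hypothesis lush2 : forall v, (2 <= hgt v)%N -> (3 <= #|children adj r v|)%N.
Hypothesis lush1 : forall v, hgt v = 1%N -> (2 <= #|children adj r v|)%N.

(** This sign allows sums weighted by [ell] to be compared term by term. *)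
Lemma lush_ell_ge0 i : (0 < i)%N -> 0 <= ell adj r i.
Proof.
case: i => // i _; rewrite /ell /= subr_ge0 lez_nat -[leqLHS]mul1n.
apply: Vset_children => // v hv.
by case: i hv => [/lush1|i hv]; [lia|have := @lush2 v; rewrite hv; lia].
Qed.

(** Three children per vertex of height 3 give [3 * #|V 3| <= #|V 2|]; strictness comes from [V 2]
    being nonempty, also when [V 3] is empty. *)
Lemma lush_Vset3_lt : (2 <= height adj r)%N -> (#|V 3|)%:Z < ell adj r 3.
Proof.
move=> H2; have h3 : (3 * #|V 3| <= #|V 2|)%N.
  by apply: Vset_children => // v hv; apply: lush2; rewrite hv.
suff : (0 < #|V 2|)%N by rewrite /ell ltrBrDr -PoszD ltz_nat [3.-1]/=; lia.
have [v hv] := Vset_nonempty treeT leaf_depth H2.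
by apply/card_gt0P; exists v; rewrite inE hv.
Qed.

Section CharPoly.
Variables (R : fieldType) (a b : nat -> R) (A : 'M[R]_n).
Hypothesis A_adj : forall i j, i != j -> ~~ adj i j -> A i j = 0.
Hypothesis A_diag : forall v, A v v = a (hgt v).+1.
Hypothesis A_child : forall v, ~~ leaf adj r v ->
  \sum_(u | child u v) A v u * A u v = b (hgt v).+1.
Local Notation p := (continuant a b).
Local Notation t := (@tofrac {poly R}).

(** The pivots live in the fraction field of the polynomials, where the elimination is done; the
    statement has the denominators cleared. *)
Lemma char_poly_hedge :
  char_poly A * \prod_v p (hgt v) = \prod_v p (hgt v).+1.
Proof.
have t0 k : t (p k) != 0 by rewrite tofrac_eq0 continuant_neq0.
apply/eqP; rewrite -tofrac_eq tofracM !rmorph_prod /=; apply/eqP.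
rewrite -(det_map_mx t).
rewrite (@det_forest _ _ child hgt _ (fun v => t (p (hgt v).+1) / t (p (hgt v)))).
- rewrite -big_split /=; apply: eq_bigr => v _; exact: divfK.
- by move=> u v /(hgt_child treeT leaf_depth) ->.
- exact: (parent_unique treeT).
- move=> v w vw cvw cwv; rewrite !mxE (negbTE vw) mulr0n A_adj ?subr0 ?rmorph0 //.
  by rewrite (adj_childE r treeT) (negbTE cvw) (negbTE cwv).
- by move=> v; rewrite mulf_neq0 // invr_neq0.
move=> v; rewrite !mxE eqxx mulr1n A_diag.
have [lv|lv] := boolP (leaf adj r v).
  rewrite big_pred0 => [|u]; last first.
    apply/negP => /(hgt_child treeT leaf_depth) e.
    by move: lv; rewrite -(hgt_eq0 treeT leaf_depth) e.
  move: lv; rewrite -(hgt_eq0 treeT leaf_depth) => /eqP -> /=.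
  by rewrite tofrac1 divr1 addr0.
have [k hk] : exists k, hgt v = k.+1.
  by move: lv; rewrite -(hgt_eq0 treeT leaf_depth); case: (hgt v) => // k _; exists k.
(* All children of [v] have the same pivot, so only the prescribed sum of the products
   [A v u * A u v] enters. *)
have -> : \sum_(u | child u v) (map_mx t (char_poly_mx A)) v u *
    (map_mx t (char_poly_mx A)) u v / (t (p (hgt u).+1) / t (p (hgt u))) =
    t (b k.+2)%:P * (t (p k) / t (p k.+1)).
  rewrite -hk -A_child // [in RHS]rmorph_sum rmorph_sum mulr_suml.
  apply: eq_bigr => u cuv; have := hgt_child treeT leaf_depth cuv.
  rewrite hk => -[<-].
  have uv : u != v by apply: contraTneq cuv => ->; rewrite child_depth // [adj v v](_ : _ = false) //; case: treeT.
  rewrite !mxE (negbTE uv) eq_sym (negbTE uv) !mulr0n !sub0r -tofracM mulrNN -polyCM.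
  by rewrite invf_div.
(* What remains is the recurrence divided by [p k.+1]. *)
rewrite hk continuantSS.
by rewrite -mul_polyC tofracB !tofracM mulrBl mulfK // !mulrA subrK.
Qed.

Lemma sum_hgt N (g : nat -> nat) : (height adj r < N)%N ->
  (\sum_v g (hgt v) = \sum_(0 <= i < N) #|V i| * g i)%N.
Proof.
move=> HN.
under [RHS]eq_bigr => i _ do rewrite -sum1_card big_distrl /=.
rewrite (exchange_big_dep predT) //=; apply: eq_bigr => v _.
have hv : (hgt v < N)%N by rewrite (leq_ltn_trans (hgt_le_height treeT leaf_depth v)).
rewrite (eq_bigl (fun i => i == hgt v)) => [|i]; last by rewrite inE eq_sym.
by rewrite big_nat1_eq hv mul1n.
Qed.

Lemma char_poly_mup x : (mup x (char_poly A))%:Z =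
  \sum_(1 <= i < n.+2) ell adj r i * (mup x (p i))%:Z.
Proof.
have := congr1 (mup x) char_poly_hedge.
rewrite mupM ?monic_neq0 ?char_poly_monic //; last first.
  by apply: monic_prod => v _; exact: continuant_monic.
rewrite !mup_prod; try by move=> v; rewrite continuant_neq0.
have Hn := height_lt treeT leaf_depth.
(* With these two bounds the ranges agree once the term of [p 0 = 1] is split off and the index
   shifted. *)
rewrite (@sum_hgt n.+2 (fun i => mup x (p i))) ?(@sum_hgt n.+1 (fun i => mup x (p i.+1))); try lia.
rewrite big_nat_recl //= (mupNroot (q := 1)) ?rootC ?oner_neq0 // muln0 add0n => e.
rewrite big_add1 /=.
under eq_bigr do rewrite /ell mulrBl.
rewrite sumrB; apply/eqP; rewrite eq_sym subr_eq; apply/eqP; move/(congr1 Posz): e.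
rewrite PoszD !(big_morph Posz PoszD (erefl _)) => e.
under eq_bigr do rewrite -PoszM.
by under [in RHS]eq_bigr do rewrite -PoszM.
Qed.

Lemma ell_sum_le_mup m j x : (0 < j)%N ->
  (forall i, (j <= i)%N -> ((i - j) %% m == 0)%N -> root (p i) x) ->
  ell_sum adj r m j <= (mup x (char_poly A))%:Z.
Proof.
move=> j0 rx; rewrite /ell_sum char_poly_mup (big_nat_widenl _ 1) // big_mkcond /=.
rewrite big_nat [leRHS]big_nat; apply: ler_sum => i /andP[i1 _].
have e0 := lush_ell_ge0 i1.
case: ifP => [/andP[ij ji]|_]; last by rewrite mulr_ge0.
rewrite -[leLHS]mulr1 ler_wpM2l // lez_nat -XsubC_dvd ?continuant_neq0 //.
by rewrite dvdp_XsubCl rx.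
Qed.

(** The boolean bound means simple roots from index 4 on and none below. *)
Lemma mup_lt_ell3 x : (2 <= height adj r)%N ->
  (forall i, (0 < i)%N -> (mup x (p i) <= (4 <= i))%N) ->
  (mup x (char_poly A))%:Z < ell adj r 3.
Proof.
move=> H2 hx; apply: le_lt_trans (lush_Vset3_lt H2); rewrite char_poly_mup.
apply: (@le_trans _ _ (\sum_(4 <= i < n.+2) ell adj r i)).
  rewrite [leRHS](big_nat_widenl _ 1) // [leRHS]big_mkcond /=.
  rewrite big_nat [leRHS]big_nat; apply: ler_sum => i /andP[i1 _].
  have e0 := lush_ell_ge0 i1; have := hx i i1.
  case: (4 <= i)%N => mi; first by rewrite -[leRHS]mulr1 ler_wpM2l.
  by move: mi; rewrite leqn0 => /eqP ->; rewrite mulr0.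
have n3 : (3 <= n.+1)%N by have := height_lt treeT leaf_depth; lia.
(* Negated cardinalities bring the summand into the telescoping form [f i.+1 - f i]. *)
rewrite big_add1 /= (eq_bigr (fun i => - (#|V i.+1|)%:Z - - (#|V i|)%:Z)).
  by rewrite telescope_sumr // opprK addrC lerBlDr lerDl.
by move=> i _; rewrite opprK addrC.
Qed.

End CharPoly.

End HedgeMatrix.

(** * Roots of the continuants of [CLambda] *)

(** Signs of products are found by recursion on the factors, with [lra] deciding the linear ones. *)
Ltac sign_gt0 :=
  first [ lra | rewrite invr_gt0; lra
        | apply: mulr_gt0; sign_gt0 | rewrite nmulr_rgt0; sign_lt0 ]
with sign_lt0 :=
  first [ lra | rewrite invr_lt0; lra
        | rewrite pmulr_rlt0; [sign_lt0 | sign_gt0]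
        | rewrite nmulr_rlt0; [sign_gt0 | sign_lt0] ].

Section RootsOfContinuant.
Variables (R : realType) (a1 a2 b2 b3 b4 : R).
Local Notation sa := (seq_a a1 a2 b2).
Local Notation sb := (seq_b a1 a2 b2 b3 b4).
Local Notation p := (continuant sa sb).
Hypothesis ab_in : inB a1 a2 b2 b3 b4.

Lemma seq_b_gt0 i : (2 <= i)%N -> 0 < sb i.
Proof.
move=> i2; have [_ h] := ab_in.
(* From index 5 on only three values recur, so six signs suffice. *)
suff [s2 s3 s4 [o2 o3 o4]] : [/\ 0 < sb 2, 0 < sb 3, 0 < sb 4 &
    [/\ 0 < (b2 - a1) * (b2 - a2), 0 < (b3 - a1) * (b3 - a2)
      & 0 < (b4 - a1) * (b4 - a2)]].
  rewrite /seq_b; case: eqP => [_//|_]; case: eqP => [_//|_]; case: eqP => [_//|_].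
  by case: (i %% 3)%N => [|[|[|]]].
rewrite /seq_b /=; clear i i2.
case: h => [h|[h|[h|[h|[h|[h|[h|[h|[h|[h|[h|h]]]]]]]]]]];
  (repeat match goal with
   | H : _ /\ _ |- _ => case: H => ? ?
   | H : is_true (_ && _) |- _ => case/andP: H => ? ?
   end); (split; [| | |split]); sign_gt0.
Qed.

(** When [p k] vanishes at [x], two steps of the recurrence make [p k.+3] a multiple of [p k.+1]
    there, with factor the difference of the two sides of the equation. *)
Lemma continuant_root_step3 k x : (x - sa k.+3) * (x - sa k.+2) = sb k.+3 ->
  root (p k) x -> root (p k.+3) x.
Proof.
move=> e /eqP px; apply/eqP.
by rewrite !(continuantSS_horner, px) -e; ring.
Qed.

Lemma seq_a_consecutive k x : (2 <= k)%N ->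
  (x - sa k.+3) * (x - sa k.+2) = (x - a1) * (x - a2).
Proof.
by case: k => [|[|k]] // _; rewrite /seq_a /=; case: (odd k) => //=; rewrite mulrC.
Qed.

Lemma continuant_root_a1 k : odd k -> root (p k) a1.
Proof.
have [m] := ubnP k; elim: m k => // m IH [|[|k]] //=; first by rewrite root_XsubC.
move=> km; rewrite negbK => ok; apply/eqP.
by rewrite (continuantSS_horner _ _ k) (eqP (IH k _ ok)) 1?ltnW // /seq_a /= ok /=; ring.
Qed.

(** The entries at index 2 are chosen so that [p 2] is [(X - a2)(X - b2)]; later even diagonal
    entries equal [a2]. *)
Lemma continuant_root_a2 k : (0 < k)%N -> ~~ odd k -> root (p k) a2.
Proof.
have [m] := ubnP k; elim: m k => // m IH [|[|[|k]]] //.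
  by move=> _ _ _; rewrite /root /= !hornerE /seq_a /seq_b /=; apply/eqP; ring.
move=> km _ ok; apply/eqP; rewrite (continuantSS_horner _ _ k.+1).
have /eqP -> : root (p k.+1) a2 by apply: IH; move: ok km => /=; [lia|lia|case: odd].
by move: ok; rewrite /seq_a /= => /negbTE ->; case: k km => //= *; ring.
Qed.

Lemma continuant_root_b2 m : root (p (3 * m + 2)) b2.
Proof.
elim: m => [|m IH].
  by rewrite /root /= !hornerE /seq_a /seq_b /=; apply/eqP; ring.
have -> : (3 * m.+1 + 2 = (3 * m + 2).+3)%N by lia.
apply: continuant_root_step3 IH; rewrite seq_a_consecutive; last lia.
rewrite /seq_b !ifN_eq; try lia.
by have -> : ((3 * m + 2).+3 %% 3 = 2)%N by lia.
Qed.

(** For [m = 0]: [p 3] is [X - a1] times [(X - a2)(X - b2) - sb 3], and [sb 3] makes the second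
    factor vanish at [b3]. *)
Lemma continuant_root_b3 m : root (p (3 * m + 3)) b3.
Proof.
elim: m => [|m IH].
  by rewrite /root /= !hornerE /seq_a /seq_b /=; apply/eqP; ring.
have -> : (3 * m.+1 + 3 = (3 * m + 3).+3)%N by lia.
apply: continuant_root_step3 IH; rewrite seq_a_consecutive; last lia.
rewrite /seq_b !ifN_eq; try lia.
by have -> : ((3 * m + 3).+3 %% 3 = 0)%N by lia.
Qed.

(** The formula for [sb 4] solves [p 4 = 0] at [b4], which requires dividing by [b4 - b2]. *)
Lemma continuant_root_b4 m : root (p (3 * m + 4)) b4.
Proof.
elim: m => [|m IH].
  have b42 : b4 - b2 != 0.
    case: ab_in; rewrite /= !inE !negb_or subr_eq0 => + _.
    by case/and5P=> _ _ /andP[_ +] _ _; rewrite eq_sym.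
  by rewrite /root /= !hornerE /seq_a /seq_b /=; apply/eqP; field.
have -> : (3 * m.+1 + 4 = (3 * m + 4).+3)%N by lia.
apply: continuant_root_step3 IH; rewrite seq_a_consecutive; last lia.
rewrite /seq_b !ifN_eq; try lia.
by have -> : ((3 * m + 4).+3 %% 3 = 1)%N by lia.
Qed.

(** Distinctness rules out [p 1] and [p 2]; [p 3] shares no root with [p 4], which vanishes at
    [b4]. *)
Lemma continuant_root_b4_ge4 k : root (p k) b4 -> (0 < k)%N -> (4 <= k)%N.
Proof.
have sb0 i : (2 <= i)%N -> sb i != 0 by move/seq_b_gt0; rewrite lt0r => /andP[].
have := continuant_root_b4 0.
case: ab_in; rewrite /= !inE !negb_or => u _.
have [h1 h2 h3] : [/\ b4 != a1, b4 != a2 & b4 != b2].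
  move: u => /and5P[/and4P[_ _ _ h1] /and3P[_ _ h2] /andP[_ h3] _ _].
  by rewrite !(eq_sym b4).
move=> r4; case: k => [|[|[|[|k]]]] //.
- by rewrite /= root_XsubC (negbTE h1).
- have -> : root (p 2) b4 = ((b4 - a2) * (b4 - b2) == 0).
    by rewrite /root; congr (_ == 0); rewrite /= !hornerE /seq_a /seq_b /=; ring.
  by rewrite mulf_eq0 !subr_eq0 (negbTE h2) (negbTE h3).
- by move/(continuant_coprime sb0); rewrite r4.
Qed.

End RootsOfContinuant.

(** * Verification of the multiplicity bounds *)

Theorem mainTheorem7 (R : realType) (n : nat) (adj : rel 'I_n) (r : 'I_n)
    (a1 a2 b2 b3 b4 : R) (A : 'M[R]_n) :
  is_lush adj r ->
  (2 <= height adj r)%N ->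
  inB a1 a2 b2 b3 b4 ->
  PH (CLambda a1 a2 b2 b3 b4 ((height adj r).+1)) A ->
  has_cml adj r A /\ cml_witness adj r A a1 a2 b2 b3 b4.
Proof.
move=> [[treeT hedgeT] [lush2 lush1]] H2 ab_in APH.
have [[A_adj _] [A_diag A_child]] := APH.
have leaf_depth l l' : leaf adj r l -> leaf adj r l' -> dist adj r l = dist adj r l'.
  case: hedgeT => [n1 _ _|]; last exact.
  by congr dist; apply: ord_inj; have := ltn_ord l; have := ltn_ord l'; lia.
set a := seq_a a1 a2 b2; set b := seq_b a1 a2 b2 b3 b4.
have A_adj0 i j : i != j -> ~~ adj i j -> A i j = 0.
  by move=> ij; rewrite -(A_adj _ _ ij) negbK => /eqP.
(* The 0-based index [height - hgt v] in size [height + 1] carries the entry numbered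
   [hgt v + 1]. *)
have A_diag' v : A v v = a (hgt adj r v).+1.
  have hv := hgt_le_height treeT leaf_depth v.
  by rewrite A_diag mxE eqxx inordK ?subSn ?leq_subr ?subKn // ltnS leq_subr.
have A_child' v : ~~ leaf adj r v ->
    \sum_(u | child adj r u v) A v u * A u v = b (hgt adj r v).+1.
  move=> lv; have hv := hgt_le_height treeT leaf_depth v.
  (* Positive height keeps the shifted index in range, so [inord] does not fall back on 0. *)
  have h0 : (0 < hgt adj r v)%N by rewrite lt0n (hgt_eq0 treeT leaf_depth).
  rewrite A_child // !mxE !inordK; [|lia..].
  rewrite eqxx !ifN_eq ?mulr1; [|lia..].
  by rewrite subSn ?leq_subr // subKn.
have low m j x : (0 < j)%N ->
    (forall i, (j <= i)%N -> ((i - j) %% m == 0)%N -> root (continuant a b i) x) ->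
    (mult x A)%:Z >= ell_sum adj r m j.
  exact: (ell_sum_le_mup treeT leaf_depth lush2 lush1 A_adj0 A_diag' A_child').
have b_gt0 := seq_b_gt0 ab_in.
have mult3 i j : (j <= i)%N -> ((i - j) %% 3 == 0)%N -> (i = 3 * ((i - j) %/ 3) + j)%N.
  by move=> ji /eqP e; have := divn_eq (i - j) 3; rewrite e; lia.
suff W : cml_witness adj r A a1 a2 b2 b3 b4.
  by split=> //; split; [case: APH | exists a1, a2, b2, b3, b4].
split; first by case: ab_in.
split; first by apply: low => // i i1 ie; apply: continuant_root_a1; lia.
split; first by apply: low => // i i1 ie; apply: continuant_root_a2; lia.
split; first by apply: low => // i i1 ie; rewrite (mult3 i 2) //; apply: continuant_root_b2.
split; first by apply: low => // i i1 ie; rewrite (mult3 i 3) //; apply: continuant_root_b3.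
split; first by apply: low => // i i1 ie; rewrite (mult3 i 4) //; apply: continuant_root_b4.
apply: (mup_lt_ell3 treeT leaf_depth lush2 lush1 A_adj0 A_diag' A_child') => // i i0.
rewrite mup_continuant //; case: (boolP (root _ _)) => // ri.
by rewrite (continuant_root_b4_ge4 ab_in ri).
Qed.
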